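(* Let $G=\mathbb{Z}^\infty=\bigoplus_{n=1}^\infty\mathbb{Z}$. Then the ratio ergodic theorem fails along every sequence $\{F_n\}_{n\ge1}$ of finite subsets of $\mathbb{Z}^\infty$.
   Context: Let a countable group $G$ act by measure-preserving transformations $x\mapsto T^g x$ on a measure space. For finite $F\subseteq G$ and $\varphi:X\to\mathbb{R}$ put $S_F(\varphi)=\sum_{g\in F}\varphi\circ T^g$ and $R_F(\varphi,\psi)=S_F(\varphi)/S_F(\psi)$ (where the denominator is nonzero). The ratio ergodic theorem holds along $\{F_n\}$ if for every ergodic measure-preserving action of $G$ on a non-atomic $\sigma$-finite measure space $(X,\mathcal{B},\mu)$ and all $\varphi,\psi\in L^1(\mu)$ with $\int\psi\,d\mu\ne 0$, we have $R_{F_n}(\varphi,\psi)\to \int\varphi\,d\mu/\int\psi\,d\mu$ $\mu$-a.e. as $n\to\infty$; it fails along $\{F_n\}$ if it does not hold. *)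

(* Defs.v *)
From HB Require Import structures.
From mathcomp Require Import all_boot all_order all_algebra finmap.
From mathcomp Require Import all_classical all_reals all_analysis.
From mathcomp Require Import -(notations) monalg.

Set Implicit Arguments.
Unset Strict Implicit.
Unset Printing Implicit Defensive.

Import Order.TTheory GRing.Theory Num.Theory.
Import numFieldNormedType.Exports.

Local Open Scope classical_set_scope.
Local Open Scope ring_scope.

(* [malg nat int] is the type of finitely supported functions from nat to
   int; only its additive group structure is used here. *)
Definition Zinf := malg nat int.
HB.instance Definition _ := GRing.Zmodule.on Zinf.

(* The group is written additively, so only actions of abelian groups are
   covered. The identities hold at every point, not just almost everywhere. *)
Definition measure_preserving_action (G : zmodType) d (X : measurableType d)
    (R : realType) (mu : {measure set X -> \bar R}) (T : G -> X -> X) : Prop :=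
  [/\ forall x, T 0 x = x,
      forall g h x, T (g + h) x = T g (T h x),
      forall g, measurable_fun [set: X] (T g) &
      forall g A, measurable A -> mu (T g @^-1` A) = mu A].

Definition ergodic (G : zmodType) d (X : measurableType d)
    (R : realType) (mu : {measure set X -> \bar R}) (T : G -> X -> X) : Prop :=
  forall A, measurable A -> (forall g, T g @^-1` A = A) ->
    mu A = 0%E \/ mu (~` A) = 0%E.

Definition atom d (X : measurableType d) (R : realType)
    (mu : {measure set X -> \bar R}) (A : set X) : Prop :=
  [/\ measurable A, (0 < mu A)%E &
      forall B, measurable B -> B `<=` A -> mu B = 0%E \/ mu (A `\` B) = 0%E].

Definition non_atomic d (X : measurableType d) (R : realType)
    (mu : {measure set X -> \bar R}) : Prop :=
  forall A, ~ atom mu A.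

Definition Ssum (G : zmodType) (X : Type) (R : realType) (T : G -> X -> X)
    (F : {fset G}) (phi : X -> R) (x : X) : R :=
  \sum_(g <- F) phi (T g x).

(* Only meaningful at points where [Ssum T F psi x != 0]. *)
Definition Rratio (G : zmodType) (X : Type) (R : realType) (T : G -> X -> X)
    (F : {fset G}) (phi psi : X -> R) (x : X) : R :=
  Ssum T F phi x / Ssum T F psi x.

(* Convergence of the ratios at x requires them to be defined for all large n,
   hence the first conjunct; x / 0 = 0 never contributes to the limit. *)
Definition ratio_ergodic_theorem_holds (R : realType) (G : zmodType)
    (F : nat -> {fset G}) : Prop :=
  forall (d : measure_display) (X : measurableType d)
    (mu : {measure set X -> \bar R}) (T : G -> X -> X),
  sigma_finite [set: X] mu -> non_atomic mu ->
  measure_preserving_action mu T -> ergodic mu T ->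
  forall phi psi : X -> R,
  mu.-integrable [set: X] (EFin \o phi) ->
  mu.-integrable [set: X] (EFin \o psi) ->
  \int[mu]_x psi x != 0 ->
  {ae mu, forall x,
    (\forall n \near \oo, Ssum T (F n) psi x != 0) /\
    Rratio T (F n) phi psi x @[n --> \oo] -->
      (\int[mu]_x phi x) / (\int[mu]_x psi x)}.

(* Main.v *)
From HB Require Import structures.
Require Import Defs.
From mathcomp Require Import all_boot all_order all_algebra finmap.
From mathcomp Require Import all_classical all_reals all_analysis.
From mathcomp Require Import measurable_realfun.
From mathcomp Require Import -(notations) monalg.
From mathcomp Require Import zify ring lra.

(** The ratio theorem compares sums over the finite sets [F n], so it fails as
soon as some action makes these sums remember where they start. There are two
reasons for this to happen.

If infinitely many [F n] involve only coordinates below a fixed [c], let the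
group act through its coordinate [c] alone, by an ergodic action of the
integers: along those [n] every element of [F n] acts trivially, the ratio of
two functions is their pointwise quotient, and no averaging takes place
([ratio_fails_bounded]).

Otherwise new coordinates keep appearing, and the sets violate the Besicovitch
covering property in the strongest form ([besicovitch]): there are indices
[n i] and elements [f i] of [F (n i)], as many as desired, such that from the
point [- f i] the set [F (n i)] reaches the origin but none of the other
points [- f k]. Give the points [- f i], [i < N], mass [1] altogether and the
origin mass [1 / N]. From each of them some sum sees as much of the origin as
of the set of all the [- f k], although the origin weighs [N] times less.
Repeating this at infinitely many scales gives a function [phi] of small
integral such that every point of a set of measure [1], with indicator
function [psi], has ratios [phi / psi] at least [1] for infinitely many [n]
([ratio_fails_unbounded]).

Such scales are stacked by a cutting and stacking construction. A [tower] is a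
sequence of finite subsets [s j] of the group: [s j.+1] contains disjoint
translates of [s j] by the elements of [C j], and more. Cut the real line at
level [j] into cells of length [1 / height C j] and label the first
[size (s j)] of them by the elements of [s j], so that passing to level
[j.+1] cuts each cell into [size (C j)] cells whose labels are translated by
[C j]. A group element moves a cell onto the cell with the translated label,
by a translation of the line; this does not depend on the level. The result is
an ergodic action ([act_action], [ergodic_tower_measure]) which preserves
Lebesgue measure on the union of the labelled cells. The unit interval carries
the labels that are sums of elements of [C 0], ..., [C j.-1], and those
elements are free to be chosen one level after the other: [C j] will consist
of the points [- f i]. *)

Set Implicit Arguments.
Unset Strict Implicit.
Unset Printing Implicit Defensive.

Import Order.TTheory GRing.Theory Num.Theory.
Import numFieldNormedType.Exports.

Local Open Scope classical_set_scope.
Local Open Scope ring_scope.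

(** * Finite subsets of the group *)

Definition below (c : nat) (g : Zinf) : Prop :=
  forall d, (c <= d)%N -> mcoeff d g = 0.

Lemma belowB c g h : below c g -> below c h -> below c (g - h).
Proof. by move=> hg hh d cd; rewrite mcoeffB hg// hh// subrr. Qed.

Lemma below0 c : below c 0.
Proof. by move=> d _; rewrite mcoeff0. Qed.

Lemma belowN c g : below c g -> below c (- g).
Proof. by move=> hg; rewrite -sub0r; apply: belowB => //; apply: below0. Qed.

Lemma belowD c g h : below c g -> below c h -> below c (g + h).
Proof. by move=> hg hh; rewrite -[h]opprK; apply/belowB/belowN. Qed.

Lemma belowW c c' g : (c <= c')%N -> below c g -> below c' g.
Proof. by move=> cc' hg d /(leq_trans cc'); apply: hg. Qed.

Lemma below_ex (g : Zinf) : exists c, below c g.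
Proof.
exists (\max_(d <- msupp g) d).+1 => d hd.
apply/eqP; rewrite mcoeff_eq0; apply/negP => dg.
have := @leq_bigmax_seq _ (enum_fset (msupp g)) xpredT (fun x => x) d dg isT.
by rewrite leqNgt hd.
Qed.

Lemma below_all (s : seq Zinf) : exists c, {in s, forall g, below c g}.
Proof.
elim: s => [|g s [c hc]]; first by exists 0%N.
have [c' hc'] := below_ex g; exists (maxn c c') => h.
rewrite inE => /predU1P[->|/hc]; apply: belowW; last exact: leq_maxl.
  exact: leq_maxr.
exact: hc'.
Qed.

Lemma exists_argmin (T : eqType) (l : T -> int) (s : seq T) :
  s != [::] -> exists2 x, x \in s & {in s, forall y, l x <= l y}.
Proof.
elim: s => // x [|y s] IH _.
  by exists x; rewrite ?inE// => z; rewrite inE => /eqP->.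
have [//|z zs hz] := IH.
have [le|lt] := lerP (l x) (l z).
  exists x; first by rewrite inE eqxx.
  by move=> w; rewrite inE => /predU1P[->//|/hz]; apply: le_trans.
exists z; first by rewrite inE zs orbT.
by move=> w; rewrite inE => /predU1P[->|/hz//]; apply: ltW.
Qed.

(** The elements are chosen one after the other, together with a homomorphism
[l] to the integers that is positive on all differences [f k - e] with [e] in
[E]. Start from an element of [F m] that involves a coordinate unknown to all
earlier choices, and let the next element minimise [l] among the members of
[F m] with the same new coordinates: subtracting an earlier [f k - e] keeps
the new coordinates and lowers [l], so it leaves [F m]. In the other direction,
earlier sets do not involve the coordinates of later elements. A large
multiple of one new coordinate, added to [l], restores positivity. *)
Lemma besicovitch (F : nat -> {fset Zinf}) (E : seq Zinf) (j N : nat) :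
  (forall c m, exists2 n, (m <= n)%N & exists2 g, g \in F n & ~ below c g) ->
  exists (n : nat -> nat) (f : nat -> Zinf), forall i, (i < N)%N ->
    [/\ (j <= n i)%N, f i \in F (n i), f i \notin E &
     forall k, (k < N)%N -> k != i -> f i - f k \notin E /\
       forall e, e \in E -> f i - f k + e \notin F (n i)].
Proof.
move=> hF.
suff: exists (n : nat -> nat) (f : nat -> Zinf) (c : nat) (l : Zinf -> int),
  [/\ forall i, (i < N)%N ->
    [/\ (j <= n i)%N, f i \in F (n i), f i \notin E &
     forall k, (k < N)%N -> k != i -> f i - f k \notin E /\
       forall e, e \in E -> f i - f k + e \notin F (n i)],
   forall x y, l (x - y) = l x - l y,
   {in E, forall e, below c e},
   forall i, (i < N)%N -> forall g, g \in F (n i) -> below c g &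
   forall i, (i < N)%N -> forall e, e \in E -> 0 < l (f i - e)].
  by move=> [n [f [c [l [h _ _ _ _]]]]]; exists n, f.
elim: N => [|N [n [f [c [l [IH lB cE cF lf]]]]]].
  have [c hc] := below_all E.
  by exists (fun=> 0%N), (fun=> 0), c, (fun=> 0); split=> // x y; rewrite subr0.
have [m jm [g gF ncg]] := hF c j.
pose fib := [seq h <- enum_fset (F m) | `[< below c (h - g) >]].
have gfib : g \in fib.
  by rewrite mem_filter gF andbT; apply/asboolP; rewrite subrr; apply: below0.
have nfib : fib != [::] by apply: contraTneq gfib => ->.
have [f1 + f1min] := exists_argmin l nfib.
rewrite mem_filter => /andP[/asboolP f1g f1F].
have nf1 : ~ below c f1.
  by move=> h; apply: ncg; rewrite -(subKr f1 g); apply: belowB.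
(* A coordinate in which [f1] differs from everything chosen earlier. *)
have [d [cd fd]] : exists d, (c <= d)%N /\ mcoeff d f1 != 0.
  apply: contra_notP nf1 => /forallNP h d cd; apply/eqP/negPn/negP => fd.
  by apply: (h d); split.
have [cm hcm] := below_all (enum_fset (F m)).
(* [K] beats every value of [l] on the [f1 - e], and the sign makes the new
   term of [l'] positive on them. *)
pose K : int := \sum_(e <- E) `|l (f1 - e)| + 1.
pose l' x := l x + Num.sg (mcoeff d f1) * K * mcoeff d x.
pose n' i := if i == N then m else n i.
pose f' i := if i == N then f1 else f i.
have old i : (i < N)%N -> [/\ f' i = f i & n' i = n i].
  by move=> iN; rewrite /f' /n' ltn_eqF.
have new : [/\ f' N = f1 & n' N = m] by rewrite /f' /n' eqxx.
have cf i : (i < N)%N -> below c (f i) by move=> iN; apply: (cF i iN); case: (IH i iN).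
have nE x : ~ below c x -> x \notin E by move=> h; apply/negP => /cE.
exists n', f', (maxn c cm), l'; split.
- move=> i; rewrite ltnS leq_eqVlt => /predU1P[->|iN].
    have [-> ->] := new; split=> //; first exact: nE.
    move=> k; rewrite ltnS leq_eqVlt => /predU1P[->|kN _]; first by rewrite eqxx.
    have [-> _] := old _ kN; split.
      by apply: nE => h; apply: nf1; rewrite -(subrK (f k) f1); apply/belowD/cf.
    move=> e eE; apply/negP => hin.
    have : f1 - f k + e \in fib.
      rewrite mem_filter hin andbT; apply/asboolP.
      have -> : f1 - f k + e - g = (f1 - g) - (f k - e).
        rewrite opprB -!addrA; congr (_ + _).
        by rewrite addrCA [RHS]addrCA [- g - _]addrC.
      by apply/belowB => //; apply/belowB; [exact: cf|exact: cE].
    move=> /f1min; have -> : f1 - f k + e = f1 - (f k - e) by rewrite opprB addrA addrAC.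
    by rewrite lB lerBrDr gerDl leNgt lf.
  have [-> ->] := old _ iN; have [h1 h2 h3 h4] := IH i iN; split=> // k.
  rewrite ltnS leq_eqVlt => /predU1P[->|kN]; last by have [-> _] := old _ kN; exact: h4.
  have [-> _] := new => _; split.
    apply: nE => h; apply: nf1; rewrite -(subKr (f i) f1); apply: belowB => //.
    exact: cf.
  move=> e eE; apply/negP => /(cF _ iN) h; apply: nf1.
  have -> : f1 = (f i + e) - (f i - f1 + e).
    by rewrite opprD opprB addrACA subrr addr0 addrC subrK.
  by apply/belowB => //; apply/belowD; [exact: cf|exact: cE].
- by move=> x y; rewrite /l' lB mcoeffB; ring.
- by move=> e /cE; apply/belowW/leq_maxl.
- move=> i; rewrite ltnS leq_eqVlt => /predU1P[->|iN] h.
    by have [_ ->] := new => /hcm; apply/belowW/leq_maxr.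
  by have [_ ->] := old _ iN => /(cF _ iN); apply/belowW/leq_maxl.
- move=> i; rewrite ltnS leq_eqVlt => /predU1P[->|iN] e eE.
    have [-> _] := new; rewrite /l' mcoeffB (cE e)// subr0 mulrAC -normrEsg.
    have : `|l (f1 - e)| <= \sum_(e <- E) `|l (f1 - e)|.
      by rewrite (big_rem e)//= lerDl sumr_ge0.
    have : 1 <= `|mcoeff d f1| by rewrite -gtz0_ge1 normr_gt0.
    rewrite /K; set S := \sum_(_ <- _) _; set a := l _; set b := `|_| => hb ha.
    have S0 : 0 <= S by rewrite sumr_ge0.
    have : S + 1 <= b * (S + 1) by rewrite ler_peMl// addr_ge0.
    have := ler_norm (- a); rewrite normrN.
    by move: ha S0; clear; lia.
  have [-> _] := old _ iN.
  have d0 : mcoeff d (f i - e) = 0 by exact: (belowB (cf _ iN) (cE _ eE)).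
  by rewrite /l' d0 mulr0 addr0 lf.
Qed.
(** * Towers *)
Definition sums (G : zmodType) (s C : seq G) : seq G :=
  [seq x + c | x <- s, c <- C].

Lemma size_sums (G : zmodType) (s C : seq G) :
  size (sums s C) = (size s * size C)%N.
Proof. exact: size_allpairs. Qed.

(** The enumeration of a sum set is lexicographic: this is what lets the cells
of two successive levels be compared by Euclidean division. *)
Lemma nth_sums (G : zmodType) (s C : seq G) k r :
  (k < size s)%N -> (r < size C)%N ->
  nth 0 (sums s C) (k * size C + r) = nth 0 s k + nth 0 C r.
Proof.
rewrite /sums; elim: s k => // x s IH [|k] /= ks rC; rewrite nth_cat size_map.
  by rewrite rC (nth_map 0).
rewrite mulSn -addnA ltnNge leq_addr/= addKn IH//.
Qed.

Definition height (G : zmodType) (C : nat -> seq G) (j : nat) : nat :=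
  \prod_(i < j) size (C i).

(** Asking for a prefix, rather than for an inclusion, puts the sub-cells of the
labelled cells first, in order; [tower_cut] makes the cells shrink, and
[tower_exhaust] makes the action of each group element defined everywhere. *)
Record tower (G : zmodType) (s C : nat -> seq G) : Prop := Tower {
  tower0 : s 0%N = [:: 0];
  tower_prefix : forall j, prefix (sums (s j) (C j)) (s j.+1);
  tower_uniq : forall j, uniq (s j);
  tower_cut : forall j, (1 < size (C j))%N;
  tower_exhaust : forall g, exists j0, forall j, (j0 <= j)%N ->
    forall x, x \in sums (s j) (C j) -> g + x \in s j.+1
}.

(** The elements of [C] may depend on all that was built before, through the
property [P]; its argument [h] will be the height. Extending each level by the
translates by [W] and by the first elements of an enumeration of the group
gives the exhaustion property. *)
Lemma tower_exists (G : zmodType) (enum : nat -> G)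
    (P : nat -> nat -> seq G -> seq G -> seq G -> Prop) :
  (forall g, exists n, enum n = g) ->
  (forall j h s, (0 < h)%N -> exists C W, [/\ (1 < size C)%N, uniq C,
     forall c c' b b', c \in C -> c' \in C -> b \in s -> b' \in s ->
       c - c' = b - b' -> c = c' & P j h s C W]) ->
  exists s C W, [/\ tower s C,
    forall j w x, w \in W j -> x \in sums (s j) (C j) -> w + x \in s j.+1 &
    forall j, P j (height C j) (s j) (C j) (W j)].
Proof.
move=> enumP step.
pose step_spec (x : nat * nat * seq G) (y : seq G * seq G) : Prop :=
  (0 < x.1.2)%N -> [/\ (1 < size y.1)%N, uniq y.1,
    forall c c' b b', c \in y.1 -> c' \in y.1 -> b \in x.2 -> b' \in x.2 ->
      c - c' = b - b' -> c = c' & P x.1.1 x.1.2 x.2 y.1 y.2].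
have [next nextP] : {next & forall x, step_spec x (next x)}.
  apply: (@choice _ _ step_spec) => -[[j h] s].
  have [h0|h0] := posnP h; first by exists ([::], [::]) => /=; rewrite /step_spec/= h0.
  by have [C [W CW]] := step j h s h0; exists (C, W) => _.
pose raise (j : nat) (hs : nat * seq G) : nat * seq G :=
  let CW := next (j, hs.1, hs.2) in
  let A := sums hs.2 CW.1 in
  ((hs.1 * size CW.1)%N,
   A ++ [seq x <- undup (sums (CW.2 ++ mkseq enum j) A) | x \notin A]).
pose state j := iteri j raise (1%N, [:: 0]).
pose CW j := next (j, (state j).1, (state j).2).
pose s j := (state j).2; pose C j := (CW j).1; pose W j := (CW j).2.
have hE j : (state j).1 = height C j.
  by elim: j => [|j IH]; rewrite /height ?big_ord0// big_ord_recr/= -/(height C j) -IH.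
have sE j : s j.+1 = sums (s j) (C j) ++
    [seq x <- undup (sums (W j ++ mkseq enum j) (sums (s j) (C j))) |
      x \notin sums (s j) (C j)] by [].
have CWP j : step_spec (j, height C j, s j) (C j, W j).
  by rewrite -hE -surjective_pairing; exact: nextP.
have h_gt0 j : (0 < height C j)%N.
  elim: j => [|j IH]; rewrite /height ?big_ord0// big_ord_recr/= muln_gt0 IH/=.
  by have [/=/ltnW] := CWP j IH.
have us j : uniq (s j).
  elim: j => // j IH; rewrite sE cat_uniq filter_uniq ?undup_uniq// andbT.
  have [/= _ uC hC _] := CWP j (h_gt0 j).
  apply/andP; split.
    apply: allpairs_uniq => // -[? ?] [? ?] /allpairsP[[x c] /= [xs cC [-> ->]]].
    move=> /allpairsP[[x' c'] /= [xs' cC' [-> ->]]] /= e.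
    have cc : c = c'.
      apply: (hC c c' x' x) => //; apply/eqP.
      by rewrite subr_eq addrAC -e addrAC subrr add0r.
    by move: e; rewrite cc => /addIr->.
  by apply/hasPn => x; rewrite mem_filter => /andP[].
have sup j w x : w \in W j ++ mkseq enum j -> x \in sums (s j) (C j) -> w + x \in s j.+1.
  move=> wW xA; rewrite sE mem_cat mem_filter mem_undup.
  have [//|/= _] := boolP (_ \in sums _ _).
  by apply/allpairsP; exists (w, x).
exists s, C, W; split.
- split=> //.
  + by move=> j; rewrite sE prefix_prefix.
  + by move=> j; have [] := CWP j (h_gt0 j).
  + move=> g; have [n <-] := enumP g; exists n.+1 => j nj x xA.
    by apply: sup => //; rewrite mem_cat; apply/orP; right; rewrite map_f// mem_iota.
- by move=> j w x wW; apply: sup; rewrite mem_cat wW.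
- by move=> j; have [] := CWP j (h_gt0 j).
Qed.
(** * Preliminaries in measure theory *)
Lemma lebesgue_translate (R : realType) (a : R) (A : set (measurableTypeR R)) :
  measurable A ->
  lebesgue_measure ((fun x : R => x + a) @^-1` A) = lebesgue_measure A.
Proof.
move=> mA.
have mf : measurable_fun [set: measurableTypeR R]
    ((fun x : R => x + a) : measurableTypeR R -> measurableTypeR R).
  by apply: continuous_measurable_fun => x; apply: cvgD; [exact: cvg_id|exact: cvg_cst].
pose f : {mfun measurableTypeR R >-> measurableTypeR R} :=
  HB.pack (fun x : R => x + a)
    (isMeasurableFun.Build _ _ (measurableTypeR R) (measurableTypeR R) _ mf).
have := @lebesgue_measure_unique R (pushforward lebesgue_measure f) _ A mA.
move=> -> //= _ [[x y] _ <-].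
rewrite /pushforward /=.
have -> : (fun x => x + a) @^-1` `]x,y] = `]x - a, y - a]%classic.
  by apply/seteqP; split => z /=; rewrite !in_itv/= ltrBlDr lerBrDr.
rewrite !lebesgue_measure_itv/= !lte_fin ltrD2r; case: ifP => // _.
by rewrite -!EFinD; congr EFin; rewrite opprB addrA subrK.
Qed.

Lemma measure_bigcup_eq0 d (T : measurableType d) (R : realType)
    (mu : {measure set T -> \bar R}) (F : nat -> set T) :
  (forall k, measurable (F k)) -> (forall k, mu (F k) = 0%E) ->
  mu (\bigcup_k F k) = 0%E.
Proof.
move=> mF F0; apply/negligibleP; first exact: bigcupT_measurable.
apply: negligible_bigcup => k; apply/negligibleP; [exact: mF|exact: F0].
Qed.

Lemma integrable_indic_fin d (T : measurableType d) (R : realType)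
    (mu : {measure set T -> \bar R}) (A : set T) :
  measurable A -> (mu A < +oo)%E -> mu.-integrable [set: T] (EFin \o \1_A).
Proof.
move=> mA Afin; apply/integrableP; split.
  by apply/measurable_EFinP; exact: measurable_indic.
under eq_integral => x _ do rewrite /= ger0_norm//.
by rewrite integral_indic// setIT.
Qed.

Lemma Rintegral_indic d (T : measurableType d) (R : realType)
    (mu : {measure set T -> \bar R}) (A : set T) :
  measurable A -> \int[mu]_x \1_A x = fine (mu A).
Proof. by move=> mA; rewrite /Rintegral integral_indic// setIT. Qed.

(** A convergent series of multiples of indicator functions, as a function with
finite values: as the blocks are disjoint, each point meets one term at
most. *)
Lemma weighted_blocks d (T : measurableType d) (R : realType)
    (mu : {measure set T -> \bar R}) (Q : nat -> set T) (b : nat -> R) (e : R) :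
  (forall j, measurable (Q j)) -> trivIset [set: nat] Q ->
  (forall j, 0 <= b j) -> 0 <= e ->
  (forall j, ((b j)%:E * mu (Q j) <= (e / (2 ^ j.+1)%:R)%:E)%E) ->
  exists psi : T -> R, [/\ forall x, 0 <= psi x, forall j x, Q j x -> psi x = b j,
    mu.-integrable [set: T] (EFin \o psi) & \int[mu]_x psi x <= e].
Proof.
move=> mQ tQ b0 e0 bQ.
pose f j x : \bar R := (b j * \1_(Q j) x)%:E.
have f0 j x : (0 <= f j x)%E by rewrite lee_fin mulr_ge0.
pose psi x := fine (\sum_(j <oo) f j x)%E.
have psiQ j x : Q j x -> (\sum_(j <oo) f j x)%E = (b j)%:E.
  move=> Qx; have f0' k : k != j -> f k x = 0%E.
    move=> kj; rewrite /f indicE memNset ?mulr0// => Qk.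
    by move/eqP: kj; apply; apply: tQ => //; exists x.
  rewrite (nneseries_split 0 j.+1)// add0n eseries0 ?adde0; last first.
    by move=> i ji _; apply: f0'; rewrite gtn_eqF.
  rewrite big_nat_recr//= big_nat_cond big1 ?add0r.
    by rewrite /f indicE mem_set// mulr1.
  by move=> i /andP[/andP[_ ij] _]; apply: f0'; rewrite ltn_eqF.
have psiE x : (psi x)%:E = (\sum_(j <oo) f j x)%E.
  rewrite /psi fineK//; have [[j Qx]|nQ] := pselect (exists j, Q j x).
    by rewrite (psiQ _ _ Qx).
  rewrite eseries0// => i _ _; rewrite /f indicE memNset ?mulr0// => Qi.
  by apply: nQ; exists i.
have mf j : measurable_fun [set: T] (f j).
  apply/measurable_EFinP; apply: measurable_funM => //; exact: measurable_indic.
have mpsi : measurable_fun [set: T] (EFin \o psi).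
  apply: (eq_measurable_fun (fun x => \sum_(0 <= j <oo | j \in xpredT) f j x)%E).
    by move=> x _; rewrite /= psiE.
  exact: ge0_emeasurable_sum.
have intle : (\int[mu]_x (psi x)%:E <= e%:E)%E.
  under eq_integral => x _ do rewrite psiE.
  rewrite integral_nneseries//.
  apply: le_trans (epsilon_trick0 xpredT e0).
  apply: lee_nneseries => j _; first by move=> _; apply: integral_ge0 => x _.
  rewrite (le_trans _ (bQ j))// /f.
  under eq_integral => x _ do rewrite EFinM.
  rewrite ge0_integralZl//; last 2 first.
    by apply/measurable_EFinP; exact: measurable_indic.
    by rewrite lee_fin.
  by rewrite integral_indic// setIT.
have int0 : (0 <= \int[mu]_x (psi x)%:E)%E.
  by apply: integral_ge0 => x _; rewrite lee_fin fine_ge0// nneseries_ge0.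
exists psi; split.
- by move=> x; rewrite fine_ge0// nneseries_ge0.
- by move=> j x Qx; rewrite /psi (psiQ _ _ Qx).
- apply/integrableP; split=> //.
  under eq_integral => x _ do rewrite /= ger0_norm ?fine_ge0 ?nneseries_ge0//.
  by apply: le_lt_trans intle _; rewrite ltry.
- rewrite /Rintegral -lee_fin fineK// ge0_fin_numE//.
  by apply: le_lt_trans intle _; rewrite ltry.
Qed.

(** The form in which both counterexamples contradict the ratio theorem: the
ratio returns above [1] while its limit should be below [1]. *)
Lemma ratio_fails_of_oscillation (R : realType) (G : zmodType) (F : nat -> {fset G})
    d (X : measurableType d) (mu : {measure set X -> \bar R}) (T : G -> X -> X)
    (phi psi : X -> R) (X0 : set X) :
  sigma_finite [set: X] mu -> non_atomic mu ->
  measure_preserving_action mu T -> ergodic mu T ->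
  mu.-integrable [set: X] (EFin \o phi) -> mu.-integrable [set: X] (EFin \o psi) ->
  \int[mu]_x psi x != 0 -> (\int[mu]_x phi x) / (\int[mu]_x psi x) < 1 ->
  measurable X0 -> mu X0 != 0%E ->
  (forall x, X0 x -> forall m, exists2 n, (m <= n)%N &
     Ssum T (F n) psi x != 0 -> 1 <= Rratio T (F n) phi psi x) ->
  ~ ratio_ergodic_theorem_holds R F.
Proof.
move=> sf na mp er iphi ipsi psi0 lt1 mX0 X00 osc.
move=> /(_ d X mu T sf na mp er phi psi iphi ipsi psi0)[B [mB B0 sub]].
move/negP: X00; apply; rewrite -measure_le0 -B0; apply: le_measure; rewrite ?inE//.
move=> x X0x; apply: sub => /= -[[m _ near0] cv].
have /cvgr_lt /(_ _ lt1) [m' _ nearlt] := cv.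
have [n nm] := osc x X0x (maxn m m').
have := nearlt n (leq_trans (leq_maxr m m') nm).
have -> /= := near0 n (leq_trans (leq_maxl m m') nm).
by rewrite ltNge => /negP + /(_ isT).
Qed.
(** * The action of a tower on the line *)
Section Dynamics.
Context (R : realType) (G : zmodType) (s C : nat -> seq G) (tw : tower s C).

Local Notation N j := (size (C j)).
Local Notation h j := (height C j).

Lemma heightS j : h j.+1 = (h j * N j)%N.
Proof. by rewrite /height big_ord_recr. Qed.

Lemma height_gt0 j : (0 < h j)%N.
Proof.
rewrite prodn_gt0// => i; exact: ltnW (tower_cut tw i).
Qed.

Lemma heightR_gt0 j : 0 < (h j)%:R :> R.
Proof. by rewrite ltr0n height_gt0. Qed.

Lemma size_towerS j : (size (s j) * N j <= size (s j.+1))%N.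
Proof.
by rewrite -size_sums; have /prefixP[e ->] := tower_prefix tw j; rewrite size_cat leq_addr.
Qed.

Lemma height_le_size j : (h j <= size (s j))%N.
Proof.
elim: j => [|j IH]; first by rewrite (tower0 tw) /height big_ord0.
by rewrite heightS (leq_trans _ (size_towerS j))// leq_mul2r IH orbT.
Qed.

Definition label j k : G := nth 0 (s j) k.
(** The cell of level [j] that contains [t]; only meaningful for [t >= 0], since
[Num.truncn] sends negative numbers to [0]. *)
Definition idx j (t : R) : nat := Num.truncn (t * (h j)%:R).
Definition pos j t : G := label j (idx j t).
Definition inside j (t : R) : Prop := 0 <= t /\ (idx j t < size (s j))%N.

Lemma labelS j k r : (k < size (s j))%N -> (r < N j)%N ->
  label j.+1 (k * N j + r) = label j k + nth 0 (C j) r.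
Proof.
move=> ks rN; rewrite /label; have /prefixP[e ->] := tower_prefix tw j.
rewrite nth_cat size_sums; have -> : (k * N j + r < size (s j) * N j)%N.
  rewrite (@leq_trans (k.+1 * N j))//; first by rewrite mulSn addnC ltn_add2r.
  by rewrite leq_mul2r ks orbT.
exact: nth_sums.
Qed.

Lemma label_inj j k k' : (k < size (s j))%N -> (k' < size (s j))%N ->
  label j k = label j k' -> k = k'.
Proof.
by move=> ks ks' /eqP; rewrite nth_uniq// ?(tower_uniq tw)// => /eqP.
Qed.

Lemma idxE j t k : 0 <= t -> (idx j t == k) =
  (k%:R / (h j)%:R <= t < k.+1%:R / (h j)%:R).
Proof.
move=> t0; rewrite truncn_eq ?mulr_ge0 ?ler0n//.
by rewrite ler_pdivrMr ?heightR_gt0// ltr_pdivlMr ?heightR_gt0.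
Qed.

Lemma idx_bounds j t : 0 <= t ->
  (idx j t)%:R <= t * (h j)%:R < (idx j t).+1%:R.
Proof. by move=> t0; rewrite truncn_itv// mulr_ge0. Qed.

Lemma idx_div j t : 0 <= t -> (idx j.+1 t %/ N j)%N = idx j t.
Proof.
move=> t0; apply/eqP; rewrite eq_sym truncn_eq ?mulr_ge0 ?ler0n//.
have /andP[lo hi] := idx_bounds j.+1 t0.
have NR0 : 0 < (N j)%:R :> R by rewrite ltr0n ltnW// (tower_cut tw).
rewrite heightS natrM mulrA in lo hi.
rewrite -(ler_pM2r NR0) -(ltr_pM2r NR0) -!natrM; apply/andP; split.
  by apply: le_trans lo; rewrite ler_nat leq_divM.
apply: (lt_le_trans hi); rewrite ler_nat ltn_ceil//.
exact: ltnW (tower_cut tw j).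
Qed.

Definition digit j t := (idx j.+1 t %% N j)%N.

Lemma digit_lt j t : (digit j t < N j)%N.
Proof. by rewrite ltn_mod ltnW// (tower_cut tw). Qed.

Lemma idxS j t : 0 <= t -> idx j.+1 t = (idx j t * N j + digit j t)%N.
Proof. by move=> t0; rewrite -(idx_div j t0) -divn_eq. Qed.

Lemma insideS j t : inside j t -> inside j.+1 t.
Proof.
move=> [t0 it]; split=> //; rewrite (leq_trans _ (size_towerS j))//.
rewrite idxS// (@leq_trans ((idx j t).+1 * N j))//; last by rewrite leq_mul2r it orbT.
by rewrite mulSn addnC ltn_add2r digit_lt.
Qed.

Lemma inside_le j j' t : (j <= j')%N -> inside j t -> inside j' t.
Proof.
move=> /subnKC <-; elim: (_ - _)%N => [|m IH]; first by rewrite addn0.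
by move=> /IH; rewrite addnS; exact: insideS.
Qed.

Lemma posS j t : inside j t -> pos j.+1 t = pos j t + nth 0 (C j) (digit j t).
Proof. by move=> [t0 it]; rewrite /pos idxS// labelS// digit_lt. Qed.

Definition moves j (g : G) (t t' : R) : Prop :=
  [/\ inside j t, inside j t', pos j t' = g + pos j t &
      t' - t = ((idx j t')%:R - (idx j t)%:R) / (h j)%:R].

(** A translation from a cell to another carries sub-cells to sub-cells of the
same rank. *)
Lemma moves_digit j g t t' : moves j g t t' -> digit j t' = digit j t.
Proof.
move=> [[t0 it] [t0' it'] _ e].
have NR0 : 0 < (N j)%:R :> R by rewrite ltr0n ltnW// (tower_cut tw).
have e' : (t' * (h j.+1)%:R) =
    t * (h j.+1)%:R + ((idx j t')%:R - (idx j t)%:R) * (N j)%:R.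
  apply/eqP; rewrite addrC -subr_eq -mulrBl e heightS natrM mulrA.
  by rewrite divfK// gt_eqF// heightR_gt0.
have : idx j.+1 t' = (idx j t' * N j + digit j t)%N.
  apply/eqP; rewrite /idx truncn_eq ?mulr_ge0 ?ler0n// e'.
  have := idx_bounds j.+1 t0; rewrite idxS// -!natr1 !natrD !natrM mulrBl.
  by move=> /andP[lo hi]; apply/andP; split; [move: lo|move: hi]; lra.
by rewrite idxS// => /addnI.
Qed.

(** The label of a sub-cell is the label of its cell translated by an element of
[C j] that depends only on its rank, so two cells whose labels differ by [g]
have sub-cells of the same rank whose labels differ by [g]. *)
Lemma movesS j g t t' : moves j g t t' -> moves j.+1 g t t'.
Proof.
move=> m; have d := moves_digit m; move: m => [it it' p e].
split; [exact: insideS|exact: insideS| |].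
  by rewrite !posS// p d addrA.
have [[t0 _] [t0' _]] := (it, it').
rewrite e !idxS// d heightS !natrD !natrM.
have NR0 : (N j)%:R != 0 :> R by rewrite gt_eqF// ltr0n ltnW// (tower_cut tw).
by field; rewrite NR0 gt_eqF// heightR_gt0.
Qed.

Lemma moves_le j j' g t t' : (j <= j')%N -> moves j g t t' -> moves j' g t t'.
Proof.
move=> /subnKC <-; elim: (_ - _)%N => [|m IH]; first by rewrite addn0.
by move=> /IH; rewrite addnS; exact: movesS.
Qed.

Lemma moves_fun j j' g t t1 t2 : moves j g t t1 -> moves j' g t t2 -> t1 = t2.
Proof.
move=> /(moves_le (leq_maxl j j')) + /(moves_le (leq_maxr j j')).
move: (maxn _ _) => J [it [_ it1] p1 e1] [_ [_ it2] p2 e2].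
have ee : idx J t1 = idx J t2 by apply: label_inj it1 it2 _; rewrite -!/(pos _ _) p1 p2.
by rewrite ee -e2 in e1; move/addIr: e1.
Qed.

Lemma moves_ex j g t : inside j t -> g + pos j t \in s j -> exists t', moves j g t t'.
Proof.
move=> [t0 it] gs; pose k' := index (g + pos j t) (s j).
have ks : (k' < size (s j))%N by rewrite index_mem.
pose t' := t + (k'%:R - (idx j t)%:R) / (h j)%:R.
have hn0 : (h j)%:R != 0 :> R by rewrite gt_eqF// heightR_gt0.
have e : t' * (h j)%:R = t * (h j)%:R + k'%:R - (idx j t)%:R.
  by rewrite /t'; field.
have /andP[lo hi] := idx_bounds j t0.
have t0' : 0 <= t'.
  by rewrite -(pmulr_lge0 _ (heightR_gt0 j)) e; move: lo (ler0n R k'); lra.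
have ik : idx j t' = k'.
  apply/eqP; rewrite truncn_eq ?mulr_ge0 ?ler0n// e; move: lo hi.
  by rewrite -!natr1 => lo hi; apply/andP; split; lra.
exists t'; split=> //; first by split; rewrite ?ik.
  by rewrite /pos ik /label nth_index.
by rewrite ik /t' addrAC subrr add0r.
Qed.

Lemma moves_comp j g g' t t' t'' :
  moves j g t t' -> moves j g' t' t'' -> moves j (g' + g) t t''.
Proof.
move=> [it it' p e] [_ it'' p' e']; split=> //; first by rewrite p' p addrA.
by rewrite -(subrKA t') e e' -mulrDl subrKA.
Qed.

Lemma moves0 j t : inside j t -> moves j 0 t t.
Proof. by move=> it; split=> //; rewrite ?add0r// !subrr mul0r. Qed.

Definition tower_space : set R := [set t | exists j, inside j t].

(** One more level is needed before [tower_exhaust] applies, because it speaks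
of the translates of [s J] inside [s J.+1]. *)
Lemma moves_total g t : tower_space t -> exists j t', moves j g t t'.
Proof.
move=> [j0 it0]; have [j1 hj1] := tower_exhaust tw g.
pose J := maxn j0 j1; have it : inside J t by apply: inside_le it0; exact: leq_maxl.
have [|t' m] := @moves_ex J.+1 g t (insideS it); last by exists J.+1, t'.
rewrite posS//; apply: hj1; first exact: leq_maxr.
apply/allpairsP; exists (pos J t, nth 0 (C J) (digit J t)); split=> //=.
  by rewrite mem_nth//; case: it.
by rewrite mem_nth// digit_lt.
Qed.

(** Outside the union of the labelled cells, [act g] is the identity. *)
Definition act (g : G) (t : R) : R := xget t [set t' | exists j, moves j g t t'].

Lemma actE j g t t' : moves j g t t' -> act g t = t'.
Proof.
move=> m; apply: xget_unique; first by exists j.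
by move=> t'' [j' m']; exact: moves_fun m' m.
Qed.

Lemma act_out g t : ~ tower_space t -> act g t = t.
Proof. by move=> nt; apply: xgetPN => t' [j [it _ _ _]]; apply: nt; exists j. Qed.

Lemma act0 t : act 0 t = t.
Proof.
have [[j it]|/act_out//] := pselect (tower_space t).
exact: (actE (moves0 it)).
Qed.

Lemma actD g g' t : act (g + g') t = act g (act g' t).
Proof.
have [it|nt] := pselect (tower_space t); last by rewrite !act_out.
have [j [t' m]] := moves_total g' it; rewrite (actE m).
have it' : tower_space t' by exists j; case: m.
have [j' [t'' m']] := moves_total g it'; rewrite (actE m').
apply: (@actE (maxn j j')); apply: moves_comp.
  by apply: moves_le m; exact: leq_maxl.
by apply: moves_le m'; exact: leq_maxr.
Qed.
(** * Invariance of the measure *)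
Local Notation lam := (@lebesgue_measure R).

Definition cell j k : set (measurableTypeR R) :=
  `[k%:R / (h j)%:R, k.+1%:R / (h j)%:R[%classic.

Lemma cellP j k t : cell j k t <-> 0 <= t /\ idx j t = k.
Proof.
have t_ge0 : cell j k t -> 0 <= t.
  by rewrite /cell /= in_itv/= => /andP[+ _]; apply: le_trans; rewrite divr_ge0.
split=> [c|[t0 /eqP]]; last by rewrite idxE// /cell/= in_itv.
have t0 := t_ge0 c; split=> //; apply/eqP; rewrite idxE//.
Qed.

Lemma measurable_cell j k : measurable (cell j k).
Proof. exact: measurable_itv. Qed.

Lemma lam_cell j k : lam (cell j k) = ((h j)%:R^-1)%:E.
Proof.
rewrite /cell lebesgue_measure_itv/= lte_fin ltr_pM2r ?invr_gt0 ?heightR_gt0//.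
by rewrite ltr_nat ltnSn -EFinD -mulrBl -natrB// subSnn mul1r.
Qed.

Lemma tower_spaceE :
  tower_space = \bigcup_j \bigcup_(k in `I_(size (s j))) cell j k.
Proof.
apply/seteqP; split=> [t [j [t0 it]]|t [j _ [k /= ks /cellP[t0 e]]]].
  by exists j => //; exists (idx j t) => //; apply/cellP.
by exists j; split; rewrite ?e.
Qed.

Lemma measurable_tower_space :
  @measurable _ (measurableTypeR R) tower_space.
Proof.
rewrite tower_spaceE; apply: bigcupT_measurable => j.
by apply: bigcup_measurable => k _; exact: measurable_cell.
Qed.

Definition tower_measure : {measure set (measurableTypeR R) -> \bar R} :=
  mrestr lam measurable_tower_space.

Lemma tower_measureE A : tower_measure A = lam (A `&` tower_space).
Proof. by []. Qed.

Lemma cell_sub j k : (k < size (s j))%N -> cell j k `<=` tower_space.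
Proof. by move=> ks; rewrite tower_spaceE => t c; exists j => //; exists k. Qed.

Lemma tower_measure_cell j k : (k < size (s j))%N ->
  tower_measure (cell j k) = ((h j)%:R^-1)%:E.
Proof. by move=> ks; rewrite tower_measureE setIidl ?lam_cell//; exact: cell_sub. Qed.

Definition reached g j k :=
  (k < size (s j))%N && (g + label j k \in s j).

Definition jump g j k : nat := index (g + label j k) (s j).

Lemma jump_lt g j k : reached g j k -> (jump g j k < size (s j))%N.
Proof. by case/andP=> _; rewrite index_mem. Qed.

Lemma label_jump g j k : reached g j k -> label j (jump g j k) = g + label j k.
Proof. by case/andP=> _ gk; rewrite /label nth_index. Qed.

Lemma moves_jump g j k t : reached g j k -> cell j k t ->
  moves j g t (act g t) /\ idx j (act g t) = jump g j k.
Proof.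
move=> rk /cellP[t0 it]; have /andP[ks gk] := rk.
have [t' m] : exists t', moves j g t t'.
  by apply: moves_ex; [split|]; rewrite /pos ?it.
rewrite (actE m); split=> //; case: m => [_ [_ it'] p _].
by apply: (label_inj it' (jump_lt rk)); rewrite label_jump// -it.
Qed.

Definition shift_of g j k : R := ((jump g j k)%:R - k%:R) / (h j)%:R.

Lemma act_shift g j k t : reached g j k -> cell j k t ->
  act g t = t + shift_of g j k.
Proof.
move=> rk ct; have [[_ _ _ e] i'] := moves_jump rk ct.
by case/cellP: ct => _ it; rewrite -(subrK t (act g t)) e i' it addrC.
Qed.

(** At a fixed level, [act g] exchanges finitely many cells by translations. The
piece of the preimage of [A] in a cell is the translate of the part of [A] in
the cell onto which it is moved; both are empty when [g] moves the cell out of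
the level. *)
Definition piece g A j k : set (measurableTypeR R) :=
  if reached g j k then cell j k `&` act g @^-1` A else set0.
Definition target g A j k : set (measurableTypeR R) :=
  if reached g j k then cell j (jump g j k) `&` A else set0.

Lemma piece_target g A j k :
  piece g A j k = (fun x => x + shift_of g j k) @^-1` (target g A j k).
Proof.
rewrite /piece /target; case: ifPn => rk; last by rewrite preimage_set0.
have cE t : cell j (jump g j k) (t + shift_of g j k) <-> cell j k t.
  rewrite /cell /= !in_itv /= /shift_of -!natr1 !mulrDl mulNr.
  by split=> /andP[lo hi]; apply/andP; split; move: lo hi; lra.
apply/seteqP; split=> t [ct At]; split.
- by apply/cE.
- by rewrite /= -(act_shift rk ct).
- by apply/cE.
- by rewrite /= (act_shift rk)//; apply/cE.
Qed.

Lemma measurable_target g A j k : measurable A -> measurable (target g A j k).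
Proof.
move=> mA; rewrite /target; case: ifP => // _.
by apply: measurableI => //; exact: measurable_cell.
Qed.

Lemma measurable_piece g A j k : measurable A -> measurable (piece g A j k).
Proof.
move=> mA; rewrite piece_target -[X in measurable X]setTI.
have mf : measurable_fun [set: measurableTypeR R]
    ((fun x : R => x + shift_of g j k) : measurableTypeR R -> measurableTypeR R).
  by apply: continuous_measurable_fun => x; apply: cvgD; [exact: cvg_id|exact: cvg_cst].
by apply: mf => //; exact: measurable_target.
Qed.

Lemma trivIset_piece g A j : trivIset [set: nat] (piece g A j).
Proof.
move=> k k' _ _ [t []]; rewrite /piece.
by case: ifP => // _ [/cellP[_ <-] _]; case: ifP => // _ [/cellP[_ <-] _].
Qed.

Lemma trivIset_target g A j : trivIset [set: nat] (target g A j).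
Proof.
move=> k k' _ _ [t []]; rewrite /target.
case: ifP => // rk [/cellP[_ e] _]; case: ifP => // rk' [/cellP[_ e'] _].
have /(congr1 (label j)) : jump g j k = jump g j k' by rewrite -e -e'.
case/andP: (rk) (rk') => ks _ /andP[ks' _].
by rewrite !label_jump// => /addrI/label_inj; exact.
Qed.

Definition piece_level g A j := \bigcup_k piece g A j k.

Lemma piece_levelP g A j t : piece_level g A j t <->
  (exists t', moves j g t t') /\ A (act g t).
Proof.
split=> [[k _]|[[t' m] At]].
  rewrite /piece; case: ifP => // rk [ct At]; split=> //.
  by exists (act g t); have [] := moves_jump rk ct.
have [[t0 it] [_ it'] p _] := m; exists (idx j t) => //.
rewrite /piece /reached it /= -/(pos j t) -p mem_nth//.
by split=> //; apply/cellP.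
Qed.

Lemma preimage_act g A : act g @^-1` A `&` tower_space = \bigcup_j piece_level g A j.
Proof.
apply/seteqP; split=> [t [At /(moves_total g)[j m]]|t [j _ /piece_levelP[[t' m] At]]].
  by exists j => //; apply/piece_levelP.
by split=> //; exists j; case: m.
Qed.

Lemma measurable_piece_level g A j : measurable A -> measurable (piece_level g A j).
Proof. by move=> mA; apply: bigcupT_measurable => k; exact: measurable_piece. Qed.

Lemma measurable_act g : measurable_fun [set: measurableTypeR R]
  (act g : measurableTypeR R -> measurableTypeR R).
Proof.
move=> _ A mA; rewrite setTI.
have -> : act g @^-1` A = (A `\` tower_space) `|` \bigcup_j piece_level g A j.
  rewrite -preimage_act; apply/seteqP; split=> t /=.
    by have [it|nt] := pselect (tower_space t); [right|rewrite act_out//; left].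
  by case=> [[At nt]|[]//]; rewrite act_out.
apply: measurableU; first by apply: measurableD => //; exact: measurable_tower_space.
by apply: bigcupT_measurable => j; exact: measurable_piece_level.
Qed.

(** The preimage of [A] is the increasing union over the levels of the disjoint
union of its pieces, whose measures are those of disjoint parts of [A]. *)
Lemma act_measure_le g A : measurable A ->
  (tower_measure (act g @^-1` A) <= tower_measure A)%E.
Proof.
move=> mA; rewrite !tower_measureE preimage_act.
have nd : nondecreasing_seq (piece_level g A).
  apply/nondecreasing_seqP => j; apply/subsetPset => t.
  move=> /piece_levelP[[t' m] At]; apply/piece_levelP; split=> //.
  by exists t'; exact: movesS.
have mL j := @measurable_piece_level g A j mA.
have cv := @nondecreasing_cvg_mu _ _ _ lam _ mL (bigcupT_measurable _ mL) nd.
rewrite -(cvg_lim _ cv)//; apply: lime_le; first by apply/cvg_ex; eexists; exact: cv.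
apply: nearW => j /=; rewrite /piece_level.
rewrite measure_bigcup//; [|by move=> k _; exact: measurable_piece|exact: trivIset_piece].
have -> : (\sum_(0 <= k <oo | k \in [set: nat]) lam (piece g A j k) =
    \sum_(0 <= k <oo | k \in [set: nat]) lam (target g A j k))%E.
  apply: eq_eseriesr => k _.
  by rewrite piece_target lebesgue_translate//; exact: measurable_target.
rewrite -measure_bigcup//; [|by move=> k _; exact: measurable_target|exact: trivIset_target].
apply: le_measure; rewrite ?inE//.
- by apply: bigcupT_measurable => k; exact: measurable_target.
- by apply: measurableI => //; exact: measurable_tower_space.
- move=> t [k _]; rewrite /target; case: ifP => // rk [ct At]; split=> //.
  exact: cell_sub (jump_lt rk) _ ct.
Qed.

(** The inequality for [- g], applied to the preimage of [A], is the converse. *)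
Lemma act_measure g A : measurable A ->
  tower_measure (act g @^-1` A) = tower_measure A.
Proof.
move=> mA; apply/eqP; rewrite eq_le act_measure_le//=.
have mgA : measurable (act g @^-1` A).
  by rewrite -[X in measurable X]setTI; exact: measurable_act.
have := act_measure_le (- g) mgA.
have -> // : act (- g) @^-1` (act g @^-1` A) = A.
by apply/seteqP; split=> t /=; rewrite -actD subrr act0.
Qed.

Lemma act_action : measure_preserving_action tower_measure act.
Proof.
split; [exact: act0|exact: actD|exact: measurable_act|exact: act_measure].
Qed.

(** * Non-atomicity and ergodicity *)
Lemma height_gt j : (j < h j)%N.
Proof.
elim: j => [|j IH]; first exact: height_gt0.
rewrite heightS; apply: (@leq_trans (h j * 2)); last by rewrite leq_mul2l (tower_cut tw) orbT.
by rewrite muln2 -addnn -addn1 leq_add// height_gt0.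
Qed.

Lemma le0_heights (x c : R) : (forall j, x <= c / (h j)%:R) -> x <= 0.
Proof.
move=> xc; rewrite leNgt; apply/negP => x0.
have := xc (Num.truncn (c / x)); rewrite leNgt => /negP; apply.
rewrite ltr_pdivrMr ?heightR_gt0// mulrC -ltr_pdivrMr//.
by apply: lt_le_trans (truncnS_gt _) _; rewrite ler_nat height_gt.
Qed.

Lemma sigma_finite_tower_measure : sigma_finite [set: measurableTypeR R] tower_measure.
Proof.
have [F FT mF] := sigma_finiteT lam; exists F => // i; have [mFi Fi] := mF i; split=> //.
apply: le_lt_trans Fi; rewrite tower_measureE; apply: le_measure; rewrite ?inE//.
by apply: measurableI => //; exact: measurable_tower_space.
Qed.

Lemma tower_measure_cell_le j k : (tower_measure (cell j k) <= ((h j)%:R^-1)%:E)%E.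
Proof.
rewrite tower_measureE -(lam_cell j k); apply: le_measure; rewrite ?inE//.
- by apply: measurableI; [exact: measurable_cell|exact: measurable_tower_space].
- exact: measurable_cell.
Qed.

Lemma eq0_cells A : measurable A -> 
  (forall j k, (k < size (s j))%N -> tower_measure (A `&` cell j k) = 0%E) ->
  tower_measure A = 0%E.
Proof.
move=> mA A0; apply/eqP; rewrite eq_le measure_ge0 andbT.
have sub : A `&` tower_space `<=`
    \bigcup_j \bigcup_k (if (k < size (s j))%N then A `&` cell j k `&` tower_space else set0).
  move=> t [At it]; have [j [t0 itj]] := it; exists j => //; exists (idx j t) => //.
  by rewrite itj; split=> //; split=> //; apply/cellP.
have mc j k : measurable (if (k < size (s j))%N then A `&` cell j k `&` tower_space else set0).
  case: ifP => // _; apply: measurableI; last exact: measurable_tower_space.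
  by apply: measurableI => //; exact: measurable_cell.
have -> : 0%E = lam (\bigcup_j \bigcup_k
    (if (k < size (s j))%N then A `&` cell j k `&` tower_space else set0)).
  apply/esym/measure_bigcup_eq0 => j; first exact: bigcupT_measurable.
  apply: measure_bigcup_eq0 => // k.
  by case: ifP => // /A0; rewrite tower_measureE.
rewrite tower_measureE; apply: le_measure; rewrite ?inE//.
- by apply: measurableI => //; exact: measurable_tower_space.
- by apply: bigcupT_measurable => j; exact: bigcupT_measurable.
Qed.

(** An atom would be concentrated in one cell of each level, and the measures of
the cells tend to [0]. *)
Lemma non_atomic_tower_measure : non_atomic tower_measure.
Proof.
move=> A [mA A0 hA].
have Asmall j : (tower_measure A <= ((h j)%:R^-1)%:E)%E.
  have [k Ak] : exists k, tower_measure (A `&` cell j k) != 0%E.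
    apply: contraPP A0 => /forallNP Ak; apply/negP; rewrite -leNgt.
    rewrite (_ : 0%E = lam (\bigcup_k (A `&` cell j k `&` tower_space))); last first.
      apply/esym/measure_bigcup_eq0 => k.
        apply: measurableI; last exact: measurable_tower_space.
        by apply: measurableI => //; exact: measurable_cell.
      by have /negP/negPn/eqP := Ak k; rewrite tower_measureE.
    rewrite tower_measureE; apply: le_measure; rewrite ?inE.
    - by apply: measurableI => //; exact: measurable_tower_space.
    - apply: bigcupT_measurable => k; apply: measurableI; last exact: measurable_tower_space.
      by apply: measurableI => //; exact: measurable_cell.
    - move=> t [At it]; exists (idx j t) => //; split=> //; split=> //.
      by apply/cellP; have [j' [t0 _]] := it.
  have mB : measurable (A `&` cell j k) by apply: measurableI => //; exact: measurable_cell.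
  have [B0|B0] := hA _ mB (@subIsetl _ _ _); first by rewrite B0 eqxx in Ak.
  apply: (@le_trans _ _ (tower_measure (A `&` cell j k))); last first.
    apply: le_trans (tower_measure_cell_le j k); apply: le_measure; rewrite ?inE//.
    exact: measurable_cell.
  rewrite -[X in (_ <= X)%E]adde0 -[X in (_ <= _ + X)%E]B0.
  rewrite -[in leLHS](setIidl (@subsetT _ A)) -(setUv (A `&` cell j k)) setIUr.
  rewrite setIA setIid -setDE.
  by apply: measureU2 => //; exact: measurableD.
have Afin : tower_measure A \is a fin_num.
  by rewrite ge0_fin_numE//; apply: le_lt_trans (Asmall 0%N) _; rewrite ltry.
move: A0 Asmall; rewrite -(fineK Afin) lte_fin => a0 Asmall.
have := @le0_heights (fine (tower_measure A)) 1.
by rewrite leNgt a0 => /(_ _)/negP; apply => // j; rewrite div1r -lee_fin.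
Qed.

Local Notation block j k := `[0%R, (k%:R / (h j)%:R)%R[%classic.

(** An invariant set occupies the same proportion of all the labelled cells of a
level, since the group permutes these cells transitively. *)
Lemma invariant_mass A j k k' : measurable A -> (forall g, act g @^-1` A = A) ->
  (k < size (s j))%N -> (k' < size (s j))%N ->
  lam (cell j k `&` A) = lam (cell j k' `&` A).
Proof.
move=> mA iA ks ks'; pose g := label j k' - label j k.
have gk : g + label j k = label j k' by rewrite subrK.
have rk : reached g j k by rewrite /reached ks gk mem_nth.
have jk : jump g j k = k' by rewrite /jump gk index_uniq// (tower_uniq tw).
have := piece_target g A j k; rewrite /piece rk iA => ->.
rewrite lebesgue_translate; last exact: measurable_target.
by rewrite /target rk jk.
Qed.

Section Invariant.
Variables (A : set (measurableTypeR R)) (mA : measurable A).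
Hypothesis iA : forall g, act g @^-1` A = A.

Let a := fine (lam (cell 0 0 `&` A)).

Let mcA j k : measurable (cell j k `&` A).
Proof. by apply: measurableI => //; exact: measurable_cell. Qed.

Let fin_cellA j k : lam (cell j k `&` A) \is a fin_num.
Proof.
rewrite ge0_fin_numE//; apply: (@le_lt_trans _ _ (lam (cell j k))).
  by apply: le_measure; rewrite ?inE//; exact: measurable_cell.
by rewrite lam_cell ltry.
Qed.

Lemma cell00 : cell 0 0 = `[0, 1[%classic.
Proof. by rewrite /cell /height big_ord0 mul0r divr1. Qed.

Let initial_mass_aux j k : (k <= size (s j))%N ->
  lam (block j k `&` A) =
    (k%:R * fine (lam (cell j 0 `&` A)))%:E.
Proof.
elim: k => [_|k IH ks].
  by rewrite !mul0r set_itvco0 set0I measure0.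
have -> : block j k.+1 = block j k `|` cell j k.
  rewrite /cell; apply/seteqP; split=> t /=; rewrite !in_itv/=.
    by move=> /andP[-> ->]; case: ltP => _; [left|right].
  case=> /andP[lo hi]; apply/andP; split=> //.
    by apply: lt_le_trans hi _; rewrite ler_pM2r ?invr_gt0 ?heightR_gt0// ler_nat.
  by apply: le_trans lo; rewrite divr_ge0.
rewrite setIUl.
transitivity (lam (block j k `&` A) + lam (cell j k `&` A))%E.
  apply: measureU => //; first by apply: measurableI => //; exact: measurable_itv.
  apply/seteqP; split=> t //= -[[+ _] [+ _]]; rewrite /cell /= !in_itv/=.
  by move=> /andP[_ h1] /andP[h2 _]; have := lt_le_trans h1 h2; rewrite ltxx.
rewrite IH ?(ltnW ks)// (invariant_mass mA iA ks (leq_ltn_trans (leq0n k) ks)).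
by rewrite -[lam (cell j 0 `&` A)]fineK// -EFinD -natr1 mulrDl mul1r.
Qed.

Let cell_mass j : fine (lam (cell j 0 `&` A)) = a / (h j)%:R.
Proof.
have := initial_mass_aux (height_le_size j).
rewrite divff ?gt_eqF ?heightR_gt0// -cell00 => e.
by rewrite /a e /= mulrC mulKf// gt_eqF// heightR_gt0.
Qed.

Lemma initial_mass j k : (k <= size (s j))%N ->
  lam (block j k `&` A) = (a * (k%:R / (h j)%:R))%:E.
Proof. by move=> ks; rewrite initial_mass_aux// cell_mass mulrCA. Qed.

Let ray (t : R) : set (measurableTypeR R) := `]-oo, t]%classic.
Let I : set (measurableTypeR R) := `[0, 1[%classic.

Let a_ge0 : 0 <= a. Proof. exact: fine_ge0. Qed.

Let mI : measurable I. Proof. exact: measurable_itv. Qed.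

(** The constant proportion passes from the cells to all initial segments of the
unit interval, by approximation from both sides at finer and finer levels. *)
Lemma ray_mass t : lam (ray t `&` (I `&` A)) = (a%:E * lam (ray t `&` I))%E.
Proof.
have [t0|t0] := ltP t 0.
  have e : ray t `&` I = set0.
    apply/seteqP; split=> x //=; rewrite /ray /I/= !in_itv/= => -[h1 /andP[h2 _]].
    by move: h1 h2; lra.
  by rewrite setIA e set0I measure0 mule0.
have [t1|t1] := leP 1 t.
  have e : ray t `&` I = I.
    by apply/setIidPr => x; rewrite /ray /I/= !in_itv/= => /andP[_ h2]; move: h2; lra.
  rewrite setIA e.
  rewrite /I -cell00 lam_cell /height big_ord0 invr1 mule1.
  by rewrite /a fineK.
have rIE : ray t `&` I = `[0, t]%classic.
  apply/seteqP; split=> x /=; rewrite /ray /I/= !in_itv/=.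
    by move=> [-> /andP[->]].
  by move=> /andP[-> h2]; split=> //; move: h2; lra.
have rI : lam (ray t `&` I) = t%:E.
  rewrite rIE lebesgue_measure_itv/= lte_fin.
  by case: ltP => [_|t0']; [rewrite -EFinD subr0|congr EFin; lra].
have mray : measurable (ray t `&` I) by rewrite rIE; exact: measurable_itv.
have finL : lam (ray t `&` (I `&` A)) \is a fin_num.
  rewrite ge0_fin_numE//; apply: (@le_lt_trans _ _ (lam (ray t `&` I))).
    by rewrite setIA; apply: le_measure; rewrite ?inE//; exact: measurableI.
  by rewrite rI ltry.
rewrite rI -EFinM -[LHS]fineK//; congr EFin.
set L := fine _.
have bound j : a * ((idx j t)%:R / (h j)%:R) <= L <= a * ((idx j t).+1%:R / (h j)%:R).
  have /andP[lo hi] : (idx j t)%:R / (h j)%:R <= t < (idx j t).+1%:R / (h j)%:R.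
    by rewrite -idxE.
  have kh : (idx j t < h j)%N.
    by rewrite truncn_lt_nat ?mulr_ge0// gtr_pMl// heightR_gt0.
  have ks := leq_trans kh (height_le_size j).
  rewrite -!lee_fin /L fineK// -!initial_mass//; last exact: ltnW.
  have mb k : measurable ((block j k : set (measurableTypeR R)) `&` A).
    by apply: measurableI => //; exact: measurable_itv.
  have mt : measurable ((`[0%R, t]%classic : set (measurableTypeR R)) `&` A).
    by apply: measurableI => //; exact: measurable_itv.
  apply/andP; split; rewrite setIA rIE; apply: le_measure; rewrite ?inE//.
    apply: setSI => x /=; rewrite !in_itv/= => /andP[-> h2]/=.
    exact: ltW (lt_le_trans h2 lo).
  apply: setSI => x /=; rewrite !in_itv/= => /andP[-> h2]/=.
  exact: le_lt_trans h2 hi.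
have tb j : (idx j t)%:R / (h j)%:R <= t < (idx j t).+1%:R / (h j)%:R by rewrite -idxE.
apply/eqP; rewrite eq_le -subr_le0 -[in X in _ && X]subr_le0; apply/andP; split.
  apply: (@le0_heights _ a) => j; have /andP[_ hL] := bound j; have /andP[lo _] := tb j.
  move: hL; rewrite -natr1 mulrDl mulrDr mul1r => hL.
  by have := ler_wpM2l a_ge0 lo; lra.
apply: (@le0_heights _ a) => j; have /andP[hL _] := bound j; have /andP[_ hi] := tb j.
have := ler_wpM2l a_ge0 (ltW hi).
by rewrite -natr1 mulrDl mulrDr mul1r; lra.
Qed.

(** If [a != 0], restricting Lebesgue measure to [A] inside the unit interval,
dividing it by [a], and leaving it unchanged outside gives a measure which
agrees with Lebesgue measure on intervals, hence everywhere. Evaluated at the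
part of [A] in the unit interval it gives [1 = a]. *)
Lemma full_mass_of_pos : a != 0 -> a = 1.
Proof.
move=> a0; have a_gt0 : 0 < a by rewrite lt_neqAle eq_sym a0.
have b0 : 0 <= a^-1 by rewrite invr_ge0.
have mIA : measurable (I `&` A) by exact: measurableI.
have mIC : measurable (~` I) by exact: measurableC.
pose m1 : {measure set (measurableTypeR R) -> \bar R} := mrestr lam mIA.
pose m2 : {measure set (measurableTypeR R) -> \bar R} := mrestr lam mIC.
pose m : {measure set (measurableTypeR R) -> \bar R} :=
  measure_add (mscale (NngNum b0) m1) m2.
have mE B : m B = ((a^-1)%:E * lam (B `&` (I `&` A)) + lam (B `&` ~` I))%E.
  have -> : m B = measure_add (mscale (NngNum b0) m1) m2 B by [].
  by rewrite measure_addE.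
have split_ray x y B : x <= y -> measurable B -> B `<=` I ->
    lam (`]x, y]%classic `&` B) = (lam (ray y `&` B) - lam (ray x `&` B))%E.
  move=> xy mB BI.
  have -> : `]x, y]%classic `&` B = (ray y `&` B) `\` (ray x `&` B).
    apply/seteqP; split=> t; rewrite /ray /= !in_itv/=.
      by move=> [/andP[xt ->] Bt]; split=> // -[tx _]; move: xt tx; lra.
    move=> [[-> Bt] nt]; split=> //; rewrite andbT ltNge; apply/negP => tx.
    exact: nt.
  have mr z : measurable (ray z `&` B) by apply: measurableI => //; exact: measurable_itv.
  rewrite measureD//.
    congr (_ - lam _)%E; apply/setIidPr => t [rt Bt]; split=> //.
    by move: rt; rewrite /ray/= !in_itv/= => /le_trans; exact.
  apply: (@le_lt_trans _ _ (lam I)).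
    by apply: le_measure; rewrite ?inE// => t [_ /BI].
  by rewrite /I lebesgue_measure_itv/= lte_fin ltr01 -EFinD ltry.
have lm : forall X, ocitv X -> lam X = m X.
  move=> _ [[x y] _ <-]; rewrite mE /=.
  have [xy|yx] := leP x y; last first.
    have -> : `]x, y]%classic = set0 :> set (measurableTypeR R).
      by rewrite set_itv_ge// bnd_simp -leNgt ltW.
    by rewrite !set0I !measure0 mule0 adde0.
  have mxy : measurable (`]x, y]%classic : set (measurableTypeR R)) by exact: measurable_itv.
  have finI z : lam (ray z `&` I) \is a fin_num.
    rewrite ge0_fin_numE//; apply: (@le_lt_trans _ _ (lam I)).
      by apply: le_measure; rewrite ?inE//; apply: measurableI => //; exact: measurable_itv.
    by rewrite /I lebesgue_measure_itv/= lte_fin ltr01 -EFinD ltry.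
  rewrite split_ray// !ray_mass -muleBr// ?fin_num_adde_defr// ?fin_numN//.
  rewrite -(split_ray _ _ I)// muleA -EFinM mulVf// mul1e addeC.
  by rewrite -setDE -measureDI.
have := lebesgue_measure_unique lm mIA.
have -> : m (I `&` A) = ((a^-1)%:E * lam (I `&` A))%E.
  rewrite mE setIid (_ : _ `&` ~` I = set0) ?measure0 ?adde0//.
  by apply/seteqP; split=> t // [[It _]].
have -> : lam (I `&` A) = a%:E by rewrite /I -cell00 /a fineK.
by rewrite -EFinM mulVf// => -[].
Qed.

Lemma null_of_zero_mass : a = 0 -> tower_measure A = 0%E.
Proof.
move=> a0; apply: eq0_cells => // j k ks.
apply/eqP; rewrite eq_le measure_ge0 andbT tower_measureE.
apply: (@le_trans _ _ (lam (cell j k `&` A))).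
  apply: le_measure; rewrite ?inE//.
  - apply: measurableI; last exact: measurable_tower_space.
    by apply: measurableI => //; exact: measurable_cell.
  - by move=> t [[At ct] _].
rewrite (invariant_mass mA iA ks (leq_ltn_trans (leq0n k) ks)).
by rewrite -[X in (X <= _)%E]fineK// cell_mass a0 mul0r.
Qed.

End Invariant.

Lemma ergodic_tower_measure : ergodic tower_measure act.
Proof.
move=> A mA iA.
have iAC g : act g @^-1` (~` A) = ~` A.
  by rewrite preimage_setC; congr (~` _); exact: iA.
have mAC := measurableC mA.
have [a0|a0] := eqVneq (fine (lam (cell 0 0 `&` A))) 0.
  by left; exact: null_of_zero_mass.
right; apply: null_of_zero_mass => //.
have a1 := full_mass_of_pos mA iA a0.
have : lam (cell 0 0) = 1%E by rewrite lam_cell /height big_ord0 invr1.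
have mc := measurable_cell 0 0.
have fin B : measurable B -> lam (cell 0 0 `&` B) \is a fin_num.
  move=> mB; rewrite ge0_fin_numE//; apply: (@le_lt_trans _ _ (lam (cell 0 0))).
    by apply: le_measure; rewrite ?inE//; exact: measurableI.
  by rewrite lam_cell ltry.
have -> : lam (cell 0 0) = (lam (cell 0 0 `&` ~` A) + lam (cell 0 0 `&` A))%E.
  by rewrite -setDE; exact: measureDI.
rewrite -(fineK (fin _ mA)) -(fineK (fin _ mAC)) a1.
by rewrite -EFinD => -[]; lra.
Qed.

Lemma inside_unit j t : cell 0 0 t -> inside j t /\ (idx j t < h j)%N.
Proof.
rewrite cell00 /= in_itv/= => /andP[t0 t1].
have kh : (idx j t < h j)%N by rewrite truncn_lt_nat ?mulr_ge0// gtr_pMl// heightR_gt0.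
by split=> //; split=> //; exact: leq_trans kh (height_le_size j).
Qed.

(** * Returns to the unit interval *)

(** At level [j.+1], the cells which carry the labels that the cells of the unit
interval have at level [j]: the origin of the covering configuration, thickened
by the positions reached at the earlier levels. *)
Definition base_block j : set (measurableTypeR R) :=
  \big[setU/set0]_(k < h j) cell j.+1 (index (label j k) (s j.+1)).

Lemma measurable_base_block j : measurable (base_block j).
Proof. by apply: bigsetU_measurable => k _; exact: measurable_cell. Qed.

Lemma base_block_measure j :
  (tower_measure (base_block j) <= ((h j)%:R / (h j.+1)%:R)%:E)%E.
Proof.
apply: (le_trans (@Boole_inequality _ _ _ tower_measure
  (fun k => cell j.+1 (index (label j k) (s j.+1))) (h j) _)).
  by move=> k _; exact: measurable_cell.
apply: (@le_trans _ _ (\sum_(k < h j) ((h j.+1)%:R^-1)%:E)%E).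
  by apply: lee_sum => k _; exact: tower_measure_cell_le.
by rewrite sumEFin sumr_const card_ord mulr_natl.
Qed.

Lemma base_blockP j t : (forall k, (k < h j)%N -> label j k \in s j.+1) ->
  base_block j t <-> inside j.+1 t /\ exists2 k, (k < h j)%N & pos j.+1 t = label j k.
Proof.
move=> lab; rewrite /base_block.
rewrite -(bigcup_mkord (h j) (fun k => cell j.+1 (index (label j k) (s j.+1)))).
split.
  move=> [k kh /cellP[t0 it]].
  split; first by split=> //; rewrite it index_mem lab.
  by exists k => //; rewrite /pos it /label nth_index// lab.
move=> [[t0 it] [k kh p]]; exists k => //; apply/cellP; split=> //.
by rewrite -p /pos /label index_uniq// (tower_uniq tw).
Qed.

Variable F : nat -> {fset G}.

(** The covering configuration at level [j], up to differences of elements of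
[s j], for the points [C j]: from the [i]-th point, [F (n i)] reaches the
origin but no other point, and it stays inside level [j.+1]; the origin is away
from the translates of [s j]. *)
Definition separated j (n : nat -> nat) : Prop := forall i, (i < N j)%N ->
  [/\ (j <= n i)%N, - nth 0 (C j) i \in F (n i),
    forall g x, g \in F (n i) -> x \in sums (s j) (C j) -> g + x \in s j.+1,
    forall b b', b \in s j -> b' \in s j -> - nth 0 (C j) i != b - b' &
    forall k b b', (k < N j)%N -> k != i -> b \in s j -> b' \in s j ->
      nth 0 (C j) k - nth 0 (C j) i + (b - b') \notin F (n i)].

Section Separated.
Variables (j : nat) (n : nat -> nat) (sep : separated j n).

Let label_in k : (k < size (s j))%N -> label j k \in s j.
Proof. exact: mem_nth. Qed.

Lemma label_return k : (k < h j)%N -> label j k \in s j.+1.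
Proof.
move=> kh; have N0 : (0 < N j)%N by exact: ltnW (tower_cut tw j).
have [_ CF hF _ _] := sep N0.
have -> : label j k = - nth 0 (C j) 0 + (label j k + nth 0 (C j) 0).
  by rewrite addrC addrK.
apply: hF => //; apply/allpairsP; exists (label j k, nth 0 (C j) 0).
split=> //=; last exact: mem_nth.
by apply: label_in; exact: leq_trans kh (height_le_size j).
Qed.

(** This makes the blocks of different levels disjoint: the block of level [j]
lies inside level [j.+1] and outside level [j]. *)
Lemma base_block_outside t : base_block j t -> ~ inside j t.
Proof.
move=> /(base_blockP _ label_return)[_ [k kh p]] it.
have [_ _ _ hne _] := sep (digit_lt j t).
have := hne (pos j t) (label j k).
rewrite !label_in ?(leq_trans kh (height_le_size j))//; last by case: it.
move=> /(_ isT isT) /negP; apply.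
by rewrite -p posS// opprD addrA subrr add0r.
Qed.

Variables (t : R) (unit_t : cell 0 0 t).
Let i := digit j t.
Let in_t : inside j t. Proof. by have [] := inside_unit j unit_t. Qed.
Let pos_in : pos j t \in s j. Proof. by apply: label_in; case: in_t. Qed.

Let moves_visit g : g \in F (n i) -> moves j.+1 g t (act g t).
Proof.
move=> gF; have [_ _ hF _ _] := sep (digit_lt j t).
have [|t' m] := @moves_ex j.+1 g t (insideS in_t); last by rewrite (actE m).
rewrite posS//; apply: hF => //; apply/allpairsP.
by exists (pos j t, nth 0 (C j) (digit j t)); split=> //=; rewrite mem_nth// digit_lt.
Qed.

Lemma visit_base_block : base_block j (act (- nth 0 (C j) i) t).
Proof.
have [_ CF _ _ _] := sep (digit_lt j t).
apply/(base_blockP _ label_return).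
have [_ it' p _] := moves_visit CF; split=> //; exists (idx j t).
  by have [] := inside_unit j unit_t.
by rewrite p posS// addrC addrK.
Qed.

(** A visit to the unit interval under [F (n i)] cannot change the digit of level
[j], so it is determined by one of the [height C j] positions at level [j]. *)
Lemma visits_unit : (count (fun g => act g t \in cell 0 0) (F (n i)) <= h j)%N.
Proof.
rewrite -size_filter -[leqRHS](size_iota 0) -(size_map (fun k => label j k - pos j t)).
apply: uniq_leq_size; first by rewrite filter_uniq// fset_uniq.
move=> g; rewrite mem_filter => /andP[/set_mem ut' gF].
have [_ _ p _] := moves_visit gF; have [it' kh'] := inside_unit j ut'.
have [_ _ _ _ hF] := sep (digit_lt j t).
have gE : g = nth 0 (C j) (digit j (act g t)) - nth 0 (C j) i +
    (pos j (act g t) - pos j t).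
  move: p; rewrite !posS// => /eqP; rewrite -subr_eq => /eqP e.
  by rewrite -[LHS]e opprD addrACA addrC.
have [e|ne] := eqVneq (digit j (act g t)) i.
  apply/mapP; exists (idx j (act g t)); first by rewrite mem_iota.
  by rewrite {1}gE e subrr add0r.
have pos_in' : pos j (act g t) \in s j by apply: label_in; case: it'.
by have := hF _ _ _ (digit_lt _ _) ne pos_in' pos_in; rewrite -gE gF.
Qed.

End Separated.
End Dynamics.

(** * The two counterexamples *)
Lemma int_enum : exists enum : nat -> int, forall z, exists n, enum n = z.
Proof.
exists (fun n => odflt 0 (choice.unpickle n)) => z; exists (choice.pickle z).
by rewrite choice.pickleK.
Qed.

Lemma Zinf_enum : exists enum : nat -> Zinf, forall g, exists n, enum n = g.
Proof.
exists (fun n => \sum_(p <- odflt [::] (@choice.unpickle (seq (nat * int)) n))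
  (mkmalgU p.1 p.2 : Zinf)) => g.
exists (choice.pickle [seq (k, mcoeff k g) | k <- enum_fset (msupp g)]).
by rewrite choice.pickleK/= big_map/= [RHS]monalgE.
Qed.

(** [0] and [2 * M + 1] have translates of [s] that are disjoint, since all
elements of [s] are at most [M] in absolute value. *)
Lemma int_tower : exists s C : nat -> seq int, tower s C.
Proof.
have [enum enumP] := int_enum.
have [|s [C [_ [tw _ _]]]] := @tower_exists _ enum (fun _ _ _ _ _ => True) enumP.
  move=> _ _ s _; pose M : int := \sum_(b <- s) `|b|.
  have M0 : 0 <= M by rewrite sumr_ge0.
  have Mb b : b \in s -> `|b| <= M.
    by move=> bs; rewrite /M (big_rem b)//= lerDl sumr_ge0.
  exists [:: 0; 2 * M + 1], [::]; split=> //.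
    by rewrite /= inE andbT; apply/eqP; lia.
  move=> c c' b b' + + /Mb + /Mb; rewrite !inE.
  by move=> /orP[] /eqP-> /orP[] /eqP->; lia.
by exists s, C.
Qed.

Section Bounded.
Context (R : realType) (F : nat -> {fset Zinf}) (c : nat).
Hypothesis Fc : forall m, exists2 n, (m <= n)%N & {in F n, forall g, below c g}.

(** The group acts through its coordinate [c], which is a surjection onto the
integers, so the action stays ergodic. The functions are the indicators of the
first cell of level [1] and of the unit interval: on that cell their ratio is
[1] whenever [F n] acts trivially, and the ratio of their integrals is less
than [1]. *)
Lemma ratio_fails_bounded : ~ ratio_ergodic_theorem_holds R F.
Proof.
have [s [C tw]] := int_tower.
pose mu := tower_measure R tw.
pose T (g : Zinf) : measurableTypeR R -> measurableTypeR R := @act R _ s C (mcoeff c g).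
have [T0 TD mT muT] := act_action R tw.
have act_T z : @act R _ s C z = T (mkmalgU c z) by rewrite /T mcoeffUU.
have mp : measure_preserving_action mu T.
  split.
  - by move=> x; rewrite /T mcoeff0 T0.
  - by move=> g h x; rewrite /T mcoeffD TD.
  - by move=> g; exact: mT.
  - by move=> g A mA; exact: muT.
have er : ergodic mu T.
  move=> A mA iA; apply: (@ergodic_tower_measure R _ s C tw A mA) => z.
  by rewrite act_T; exact: iA.
have sz1 : (1 < size (s 1%N))%N := leq_trans (height_gt tw 1) (height_le_size tw 1).
have m0 : mu (@cell R _ C 0 0) = 1%E.
  by rewrite /mu tower_measure_cell ?(tower0 tw)// /height big_ord0 invr1.
have m1 : mu (@cell R _ C 1 0) = ((height C 1)%:R^-1)%:E.
  by rewrite /mu tower_measure_cell// ltnW.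
have mc j k : measurable (@cell R _ C j k) by exact: measurable_cell.
have i0 : \int[mu]_x \1_(@cell R _ C 0 0) x = 1 by rewrite Rintegral_indic// m0.
have i1 : \int[mu]_x \1_(@cell R _ C 1 0) x = (height C 1)%:R^-1.
  by rewrite Rintegral_indic// m1.
have h1 : 1 < (height C 1)%:R :> R by rewrite ltr1n (height_gt tw 1).
have sub x : @cell R _ C 1 0 x -> @cell R _ C 0 0 x.
  move=> /(@cellP R _ s C tw)[x0 ix]; apply/(@cellP R _ s C tw); split=> //.
  by rewrite -(idx_div tw)// ix div0n.
apply: (@ratio_fails_of_oscillation R _ F _ _ mu T
  (\1_(@cell R _ C 1 0)) (\1_(@cell R _ C 0 0)) (@cell R _ C 1 0)).
- exact: sigma_finite_tower_measure.
- exact: non_atomic_tower_measure.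
- exact: mp.
- exact: er.
- by apply: integrable_indic_fin => //; rewrite [X in (X < _)%E]m1 ltry.
- by apply: integrable_indic_fin => //; rewrite [X in (X < _)%E]m0 ltry.
- by rewrite i0 oner_eq0.
- by rewrite i0 i1 divr1 invf_lt1// (lt_trans ltr01).
- exact: mc.
- by rewrite m1 eqe invr_eq0 gt_eqF// (lt_trans ltr01).
- move=> x xc m; have [n mn Fn] := Fc m; exists n => //.
  have e (phi : R -> R) : Ssum T (F n) phi x = \sum_(g <- F n) phi x.
    rewrite /Ssum big_seq [RHS]big_seq; apply: eq_bigr => g gF.
    by rewrite /T (Fn g gF c (leqnn c)) T0.
  rewrite /Rratio !e !indicE !mem_set//; last exact: sub.
  by move=> ne0; rewrite divff.
Qed.

End Bounded.

Section Unbounded.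
Context (R : realType) (F : nat -> {fset Zinf}).
Hypothesis hF : forall c m, exists2 n, (m <= n)%N & exists2 g, g \in F n & ~ below c g.

(** The size of [C j] makes the total weight of the blocks, each counted
[height C j] times, at most [1 / 2]. *)
Lemma separated_tower : exists (s C : nat -> seq Zinf), tower s C /\ forall j,
  size (C j) = (height C j * 2 ^ j.+2)%N /\ exists n, separated s C F j n.
Proof.
have [enum enumP] := Zinf_enum.
pose P j h (s C W : seq Zinf) := size C = (h * 2 ^ j.+2)%N /\
  exists n, forall i, (i < size C)%N -> [/\ (j <= n i)%N, - nth 0 C i \in F (n i),
    {subset F (n i) <= W},
    forall b b', b \in s -> b' \in s -> - nth 0 C i != b - b' &
    forall k b b', (k < size C)%N -> k != i -> b \in s -> b' \in s ->
      nth 0 C k - nth 0 C i + (b - b') \notin F (n i)].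
have [|s [C [W [tw hW hP]]]] := @tower_exists _ enum P enumP.
  move=> j h s h0; pose N := (h * 2 ^ j.+2)%N.
  (* The element [0] of [E] makes the [f i] pairwise distinct. *)
  pose E : seq Zinf := 0 :: [seq b - b' | b <- s, b' <- s].
  have inE b b' : b \in s -> b' \in s -> b - b' \in E.
    by move=> bs bs'; rewrite in_cons; apply/orP; right; apply/allpairsP; exists (b, b').
  have [n [f nf]] := besicovitch E j N hF.
  pose C := mkseq (fun i => - f i) N.
  have CE i : (i < N)%N -> nth 0 C i = - f i by exact: nth_mkseq.
  have N1 : (1 < N)%N.
    by rewrite (@leq_trans (2 ^ j.+2))// ?leq_pmull// expnS leq_pmulr// expn_gt0.
  have sub c c' b b' : c \in C -> c' \in C -> b \in s -> b' \in s ->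
      c - c' = b - b' -> c = c'.
    move=> /mapP[i]; rewrite mem_iota => /= iN -> /mapP[k]; rewrite mem_iota => /= kN ->.
    move=> bs bs' e; have [->//|ki] := eqVneq i k.
    have [_ _ _ /(_ k kN)] := nf i iN; rewrite eq_sym => /(_ ki)[+ _].
    have -> : f i - f k = b' - b by rewrite -[RHS]opprB -e opprB opprK addrC.
    by rewrite inE.
  exists C, (flatten [seq enum_fset (F (n i)) | i <- iota 0 N]).
  split; rewrite ?size_mkseq//.
  - rewrite map_inj_in_uniq ?iota_uniq// => i k; rewrite !mem_iota /= => iN kN /oppr_inj e.
    apply/eqP/negPn/negP => ik.
    have [_ _ nfE /(_ k kN)] := nf i iN; rewrite eq_sym => /(_ ik)[+ _].
    by rewrite e subrr mem_head.
  - split; first by rewrite size_mkseq.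
    exists n => i; rewrite size_mkseq => iN; have [jn fF fE hk] := nf i iN.
    rewrite CE// opprK; split=> //.
    + move=> g gF; apply/flattenP; exists (enum_fset (F (n i))) => //.
      by apply/mapP; exists i; rewrite ?mem_iota.
    + by move=> b b' bs bs'; apply: contraNneq fE => ->; exact: inE.
    + move=> k b b' kN ki bs bs'; rewrite CE// [- f k + _]addrC.
      by have [_] := hk k kN ki; apply; exact: inE.
exists s, C; split=> // j; have [hC [n hn]] := hP j; split=> //.
exists n => i iN; have [jn CF FW hne hk] := hn i iN; split=> //.
by move=> g x gF; apply: hW; exact: FW.
Qed.

(** The function [psi] of the proof is [height C m] on the block of level [m].
From a point of the unit interval whose digit at level [m] is [i], the sum of
[psi] over [F (n m i)] is at least [height C m], by the visit to the block, and
the number of visits to the unit interval is at most [height C m]. *)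
Lemma ratio_fails_unbounded : ~ ratio_ergodic_theorem_holds R F.
Proof.
have [s [C [tw sizeC_sep]]] := separated_tower.
have sizeC j := (sizeC_sep j).1.
have [n sep] := choice (fun j => (sizeC_sep j).2).
pose mu := tower_measure R tw.
pose T : Zinf -> measurableTypeR R -> measurableTypeR R := @act R _ s C.
pose h j : R := (height C j)%:R.
have h_gt0 j : 0 < h j by exact: (heightR_gt0 R tw).
have mB j : measurable (@base_block R _ s C j) by exact: measurable_base_block.
have tB : trivIset [set: nat] (@base_block R _ s C).
  have lt_disj j k x : (j < k)%N ->
      @base_block R _ s C j x -> @base_block R _ s C k x -> False.
    move=> jk Bj Bk; apply: (base_block_outside tw (sep k) Bk).
    apply: (inside_le tw jk).
    by have /(base_blockP tw _ (label_return tw (sep j)))[] := Bj.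
  move=> j k _ _ [x [Bj Bk]]; case: (ltngtP j k) => // jk.
    by have := lt_disj _ _ _ jk Bj Bk.
  by have := lt_disj _ _ _ jk Bk Bj.
have hB j : ((h j)%:E * mu (@base_block R _ s C j) <= (2^-1 / (2 ^ j.+1)%:R)%:E)%E.
  apply: (le_trans (lee_wpmul2l _ (base_block_measure R tw j))).
    by rewrite lee_fin ltW.
  rewrite -EFinM lee_fin heightS sizeC (expnS 2 j.+1) !natrM -/(h j).
  have p_gt0 : 0 < (2 ^ j.+1)%:R :> R by rewrite ltr0n expn_gt0.
  rewrite le_eqVlt; apply/orP; left; apply/eqP.
  by field; rewrite (gt_eqF p_gt0) (gt_eqF (h_gt0 j)).
have half_ge0 : 0 <= 2^-1 :> R by rewrite invr_ge0.
have [psi [psi0 psiB ipsi psile]] :=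
  weighted_blocks mB tB (fun j => ltW (h_gt0 j)) half_ge0 hB.
have m0 : mu (@cell R _ C 0 0) = 1%E.
  by rewrite /mu tower_measure_cell ?(tower0 tw)// /height big_ord0 invr1.
have i0 : \int[mu]_x \1_(@cell R _ C 0 0) x = 1.
  by rewrite Rintegral_indic ?m0//; exact: measurable_cell.
have mc : measurable (@cell R _ C 0 0) by exact: measurable_cell.
apply: (@ratio_fails_of_oscillation R _ F _ _ mu T
  psi (\1_(@cell R _ C 0 0)) (@cell R _ C 0 0)).
- exact: sigma_finite_tower_measure.
- exact: non_atomic_tower_measure.
- exact: act_action.
- exact: ergodic_tower_measure.
- exact: ipsi.
- by apply: integrable_indic_fin => //; rewrite [X in (X < _)%E]m0 ltry.
- by rewrite i0 oner_eq0.
- by rewrite i0 divr1 (le_lt_trans psile)// invf_lt1// ltr1n.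
- exact: mc.
- by rewrite m0 eqe oner_eq0.
- move=> x xc m; pose i := digit C m x.
  have [mn CF _ _ _] := sep m i (digit_lt tw m x).
  exists (n m i) => // ne0.
  have le_h : Ssum T (F (n m i)) \1_(@cell R _ C 0 0) x <= h m.
    rewrite /Ssum; under eq_bigr do rewrite indicE.
    have := visits_unit tw (sep m) xc; rewrite -(ler_nat R).
    by apply: le_trans; rewrite -natr_sum ler_nat -sum1_count [leqRHS]big_mkcond.
  have ge_h : h m <= Ssum T (F (n m i)) psi x.
    rewrite /Ssum (big_fsetD1 _ CF)/= -(psiB m (T (- nth 0 (C m) i) x)); last first.
      exact: (visit_base_block tw (sep m) xc).
    by rewrite lerDl sumr_ge0.
  rewrite /Rratio ler_pdivlMr ?mul1r; first exact: le_trans le_h ge_h.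
  rewrite lt_neqAle eq_sym ne0/=; apply: sumr_ge0 => g _.
  by rewrite indicE.
Qed.

End Unbounded.

Theorem theorem1p2 (R : realType) (F : nat -> {fset Zinf}) :
  ~ ratio_ergodic_theorem_holds R F.
Proof.
have [[c Fc]|nFc] := pselect (exists c, forall m, exists2 n, (m <= n)%N &
    {in F n, forall g, below c g}).
  exact: ratio_fails_bounded Fc.
apply: ratio_fails_unbounded => c m; apply: contra_notP nFc => hc.
exists c => m'; exists (maxn m m'); first exact: leq_maxr.
move=> g gF; apply: contra_notP hc => ng.
by exists (maxn m m'); [exact: leq_maxl|exists g].
Qed.
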